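(* Let $X$ be a compact automatic space. Then the $\mathbb Z$-system $(\overset{\leftrightarrow}{X},\overset{\leftrightarrow}{s})$ and the $\mathbb N$-system $(\overset{\rightarrow}{X},\overset{\rightarrow}{s})$ are sofically presented.
   Context: A set $Y\subset A^{\mathbb N}$ ($A$ a finite alphabet) is $\omega$-automatic if it is an $\omega$-regular language (accepted by a finite automaton on infinite words). A compact automatic space is a topological space of the form $Y/Z$ (topological quotient) where, for some finite alphabet $A$, $Y\subset A^{\mathbb N}$ is a closed $\omega$-automatic set and $Z\subset Y^2\subset(A^2)^{\mathbb N}$ is a closed $\omega$-automatic equivalence relation on $Y$. For a topological space $X$, $\overset{\rightarrow}{X}=(X\times\mathbb N)\cup\{\infty\}$ where $\infty$ is the point of the one-point compactification of $X\times\mathbb N$ ($\mathbb N$ discrete, $0\in\mathbb N$), with $\overset{\rightarrow}{s}(\infty)=\overset{\rightarrow}{s}(x,0)=\infty$ and $\overset{\rightarrow}{s}(x,n+1)=(x,n)$. Similarly $\overset{\leftrightarrow}{X}=(X\times\mathbb Z)\cup\{\infty\}$ is the one-point compactification of $X\times\mathbb Z$, with $\overset{\leftrightarrow}{s}(\infty)=\infty$ and $\overset{\leftrightarrow}{s}(x,n)=(x,n-1)$. Let $M\in\{\mathbb N,\mathbb Z\}$. A subshift over $M$ is a closed shift-invariant subset of $\Sigma^M$, $\Sigma$ a finite alphabet; it is an SFT if defined by finitely many forbidden words, and sofic if it is the image of an SFT under a continuous shift-commuting map. A dynamical $M$-system is sofically presented if it is conjugate (equivariantly homeomorphic) to $Y/Z$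 for some sofic shifts $Y\subset\Sigma^M$, $Z\subset(\Sigma^2)^M\cong\Sigma^M\times\Sigma^M$ such that $Z\cap Y^2$ is an equivalence relation on $Y$, where $Y/Z$ is the topological quotient $Y/(Z\cap Y^2)$ with the induced shift action. *)

(* Defs.v *)
From HB Require Import structures.
From mathcomp Require Import all_boot all_order all_algebra.
From mathcomp Require Import generic_quotient.
From mathcomp Require Import boolp classical_sets functions.
From mathcomp Require Import topology.

Set Implicit Arguments.
Unset Strict Implicit.
Unset Printing Implicit Defensive.

Import GRing.Theory.

Local Open Scope classical_set_scope.
Local Open Scope ring_scope.
Local Open Scope quotient_scope.

Definition homeomorphism (X Y : topologicalType) (f : X -> Y) : Prop :=
  exists g : Y -> X, [/\ cancel f g, cancel g f, continuous f & continuous g].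

(* A^M with the product of the discrete topologies. *)
Definition config (M A : Type) : Type :=
  prod_topology (fun _ : M => discrete_topology A).

HB.instance Definition _ (M : Type) (A : choiceType) :=
  Topological.on (config M A).

(* The identification of A^M x A^M with (A^2)^M. *)
Definition pairc (M A : Type) (x y : config M A) : config M (A * A) :=
  fun i => (x i, y i).

Section TopologicalQuotient.
Context {M : Type} {A : choiceType} {Y : set (config M A)}.

(* [e], an equivalence relation on the subspace Y, is the restriction of Z to
   Y x Y. Given Y and Z, such an [e] exists iff the intersection of Z and Y x Y
   is an equivalence relation on Y, and it is then unique. *)
Definition restricts_to (Z : set (config M (A * A))) (e : equiv_rel Y) : Prop :=
  forall x y : Y, e x y <-> Z (pairc (set_val x) (set_val y)).

Definition quot (e : equiv_rel Y) : topologicalType :=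
  quotient_topology {eq_quot e}.

End TopologicalQuotient.

Record buchi_automaton (A : Type) := BuchiAutomaton {
  buchi_state : finType;
  buchi_init : {set buchi_state};
  buchi_trans : buchi_state -> A -> {set buchi_state};
  buchi_accept : {set buchi_state} }.

Definition buchi_run (A : Type) (B : buchi_automaton A) (w : nat -> A)
    (r : nat -> buchi_state B) : Prop :=
  r 0%N \in buchi_init B /\
  forall i : nat, r i.+1 \in buchi_trans (r i) (w i).

Definition buchi_language (A : Type) (B : buchi_automaton A) :
    set (config nat A) :=
  [set w | exists2 r : nat -> buchi_state B, buchi_run w r &
    forall n : nat, exists2 m : nat, (n <= m)%N & r m \in buchi_accept B].

Definition omega_automatic (A : finType) (L : set (config nat A)) : Prop :=
  exists B : buchi_automaton A, L = buchi_language B.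

Definition compact_automatic_space (X : topologicalType) : Prop :=
  exists (A : finType) (Y : set (config nat A))
         (Z : set (config nat (A * A))) (e : equiv_rel Y),
    [/\ closed Y /\ omega_automatic Y,
        closed Z /\ omega_automatic Z,
        forall x y, Z (pairc x y) -> Y x /\ Y y,
        restricts_to Z e &
        exists f : quot e -> X, homeomorphism f].

(* The semiring M is only meant to be nat or int; its structure is used to treat
   both cases at once. *)
Section Shifts.
Variable M : pzSemiRingType.

Definition shift_by (A : Type) (m : M) (x : config M A) : config M A :=
  fun i => x (i + m).

Definition subshift (A : finType) (Y : set (config M A)) : Prop :=
  closed Y /\ forall (m : M) (x : config M A), Y x -> Y (shift_by m x).

Definition occurs_at (A : Type) (w : seq A) (x : config M A) (i : M) : Prop :=
  w = mkseq (fun k => x (i + k%:R)) (size w).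

Definition sft (A : finType) (Y : set (config M A)) : Prop :=
  subshift Y /\
  exists F : seq (seq A),
    Y = [set x | forall (w : seq A) (i : M), w \in F -> ~ occurs_at w x i].

Definition sofic (A : finType) (Y : set (config M A)) : Prop :=
  subshift Y /\
  exists (B : finType) (S : set (config M B)) (f : config M B -> config M A),
    [/\ sft S,
        {within S, continuous f},
        forall (m : M) (x : config M B), S x ->
          f (shift_by m x) = shift_by m (f x) &
        Y = f @` S].

Section QuotientShift.
Context {A : finType} {Y : set (config M A)}.

Definition subshift_map (sY : subshift Y) (y : Y) : Y :=
  SigSub (mem_set (sY.2 1 (set_val y) (set_valP y))).

Definition quot_shift (sY : subshift Y) (e : equiv_rel Y) : quot e -> quot e :=
  lift_op1 {eq_quot e} (subshift_map sY).

End QuotientShift.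

(* An M-system is given by the map [s] by which 1 in M acts. For M = int, a
   bijection intertwining the maps by which 1 acts also intertwines their
   inverses, so that in both cases [f] below is M-equivariant. *)
Definition sofically_presented (X : topologicalType) (s : X -> X) : Prop :=
  exists (A : finType) (Y : set (config M A)) (Z : set (config M (A * A)))
         (sY : sofic Y) (e : equiv_rel Y),
    [/\ sofic Z,
        restricts_to Z e &
        exists2 f : quot e -> X, homeomorphism f &
          forall q : quot e, f (quot_shift sY.1 q) = s (f q)].

End Shifts.

Definition arrow_space (M : choiceType) (X : topologicalType) :
    topologicalType :=
  one_point_compactification (X * discrete_topology M)%type.

Definition right_arrow (X : topologicalType) : topologicalType :=
  arrow_space nat X.

Definition right_arrow_map (X : topologicalType) (p : right_arrow X) :
    right_arrow X :=
  match p with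
  | Some (x, n.+1) => Some (x, n)
  | _ => None
  end.

Definition leftright_arrow (X : topologicalType) : topologicalType :=
  arrow_space int X.

Definition leftright_arrow_map (X : topologicalType) (p : leftright_arrow X) :
    leftright_arrow X :=
  match p with
  | Some (x, n) => Some (x, (n : int) - 1)
  | None => None
  end.

(* Main.v *)
Require Import Defs.
From HB Require Import structures.
From mathcomp Require Import all_boot all_order all_algebra.
From mathcomp Require Import generic_quotient zify.
From mathcomp Require Import boolp classical_sets functions cardinality.
From mathcomp Require Import topology.

(** Write X = Y / Z with Y and Z closed and omega-regular. The point (x, n) of
    the arrow space, where x is the class of the word w in Y, is encoded by the
    marked word: the configuration that is blank at every position before n
    and carries w from position n on, the first letter of w bearing a mark.
    Every configuration without a mark encodes the point at infinity. The mark
    is what distinguishes, over nat, the code of (x, 0) from its image under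
    the shift, which has to encode infinity.

    A closed omega-regular language is the set of labels of all infinite runs
    of a finite automaton without acceptance condition
    (closed_omega_automatic_safety): restrict a Buechi automaton to the states
    from which an accepting run exists. Hence the transition rule of the
    automaton, with blanks and marks added, is a nearest-neighbour rule, and the
    projections of the configurations obeying it form a sofic shift Y'
    (marked_shift). It contains all marked words over Y, the blank
    configuration, and possibly further configurations without a mark, namely
    limits of marked words whose mark escapes to minus infinity
    (marked_shiftP). The same construction applied to Z, together with all
    pairs of configurations without mark, yields a sofic shift Z'
    (marked_pair_shift) whose trace on Y' is the relation of encoding the same
    point (marked_pair_shiftP, decodeP).

    The decoding map from Y' to the arrow space is continuous: near a marked
    word because finitely many letters determine a neighbourhood of the word in
    Y, and near an unmarked configuration because a compact subset of the
    product of X with the discrete set M meets only finitely many levels. Its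
    inverse modulo Z' is continuous at infinity because a closed subset of Y'
    all of whose elements are marked is compact, so that only finitely many
    positions of the mark occur in it. Neither argument uses that X is
    Hausdorff.

    Over M = nat and M = int the argument is the same; it uses only the few
    properties of M collected in line_like. *)

Set Implicit Arguments.
Unset Strict Implicit.
Unset Printing Implicit Defensive.

Import GRing.Theory.

Local Open Scope classical_set_scope.
Local Open Scope ring_scope.
Local Open Scope quotient_scope.

(** * Topology of configuration spaces *)

Section ConfigTopology.
Variables (M : Type) (A : choiceType).

Lemma cvg_config (T : Type) (F : set_system T) (FF : Filter F)
    (h : T -> config M A) (x : config M A) :
  (forall i, \forall t \near F, h t i = x i) -> h @ F --> x.
Proof.
move=> hx; apply/cvg_sup => i U [V [[W _ <-] Wx] VU].
by apply: filterS (hx i) => t /= e; apply: VU; rewrite /= e.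
Qed.

Lemma near_coord (x : config M A) (i : M) : \forall y \near x, y i = x i.
Proof.
have /cvg_sup/(_ i) xi : nbhs x --> x by exact: cvg_id.
apply: xi; exists ((@^~ i) @^-1` [set x i]); split => //.
by exists [set x i] => //; exact: (@discrete_open (discrete_topology A)).
Qed.

Lemma continuous_config (T : topologicalType) (h : T -> config M A) :
  (forall t i, \forall t' \near t, h t' i = h t i) -> continuous h.
Proof. by move=> hc t; exact: cvg_config (hc t). Qed.

Lemma config_hausdorff : hausdorff_space (config M A).
Proof.
move=> x y xy; apply: funext => i.
have [z [<- <-]] : [set z | z i = x i] `&` [set z | z i = y i] !=set0.
  exact: xy (near_coord x i) (near_coord y i).
by [].
Qed.

End ConfigTopology.

Lemma config_compact (M : eqType) (A : finType) : compact [set: config M A].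
Proof.
have cA (i : M) : compact [set: discrete_topology A].
  by apply: finite_compact; exact: (@finite_finset A).
suff -> : [set: config M A] = [set f | forall i, setT (f i)].
  exact: tychonoff cA.
by apply/seteqP; split.
Qed.

Lemma near_coords (M : eqType) (A : choiceType) (D : seq M) (x : config M A) :
  \forall y \near x, forall i, i \in D -> y i = x i.
Proof.
elim: D => [|i D IH]; first by apply: filterE.
apply: filterS2 (near_coord x i) IH => y yi yD j.
by rewrite inE => /orP[/eqP->|/yD].
Qed.

(** Finite subcover extraction, from a family of sets that need not be open but
    contains a neighbourhood of each point of K. *)
Lemma compact_finite_choice (T : topologicalType) (I : choiceType) (K : set T)
    (R : I -> set T) :
  compact K -> (forall x, K x -> exists i, nbhs x (R i)) ->
  exists D : seq I, forall x, K x -> exists2 i, i \in D & R i x.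
Proof.
move=> /compact_near_coveringP cK KR.
(* The filter generated by the cones above finite lists of indices; the near
   covering property for it says that some list works for all of K. *)
pose F : set_system (seq I) :=
  [set S | exists D0 : seq I, forall D : seq I, {subset D0 <= D} -> S D].
have FF : Filter F.
  split; first by exists [::].
    move=> S S' [D0 h0] [D1 h1]; exists (D0 ++ D1) => D sD; split.
      by apply: h0 => i iD; apply: sD; rewrite mem_cat iD.
    by apply: h1 => i iD; apply: sD; rewrite mem_cat iD orbT.
  by move=> S S' SS' [D0 h0]; exists D0 => D /h0/SS'.
have [x Kx|D0 /(_ D0) h] := cK _ F (fun D x => exists2 i, i \in D & R i x) FF.
  have [i Ri] := KR x Kx.
  exists (R i, [set D | i \in D]); first split=> //=.
    by exists [:: i] => D /(_ i); apply; rewrite mem_head.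
  by move=> [y D] /= [Riy iD]; exists i.
by exists D0; exact: h.
Qed.

Lemma compact_set_type (T : topologicalType) (K : set T) :
  compact K -> compact [set: K].
Proof.
move=> cK F FF _.
have FK : ((set_val : K -> T) @ F) K.
  suff KE : (set_val : K -> T) @^-1` K = setT.
    by rewrite /fmap /= KE; exact: filterT.
  by apply/seteqP; split => // x _; exact: set_valP.
have [x [Kx xF]] := cK _ _ FK.
exists (SigSub (mem_set Kx)); split => // S U FS [_ [[W oW <-] Wx] WU].
have [_ [[z Sz <-] Wz]] : (set_val @` S) `&` W !=set0.
  apply: xF; last exact: open_nbhs_nbhs.
  by move: FS; apply: (@filterS K F) => z Sz; exists z.
by exists z; split => //; exact: WU.
Qed.

Lemma cvg_set_type (T : topologicalType) (K : set T) (I : Type)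
    (F : set_system I) (FF : Filter F) (h : I -> K) (x : K) :
  (set_val \o h) @ F --> set_val x -> h @ F --> x.
Proof.
move=> hx U [_ [[W oW <-] Wx] WU].
have : (set_val \o h @ F) W by apply: hx; exact: open_nbhs_nbhs.
by apply: (@filterS _ F FF) => i Wi; exact: WU.
Qed.

(** * Nearest-neighbour shifts and their letter-to-letter images *)

Section VertexShift.
Variable M : pzSemiRingType.

(** The configurations all of whose pairs of consecutive letters satisfy R. *)
Definition vertex_shift (B : Type) (R : rel B) : set (config M B) :=
  [set x | forall i, R (x i) (x (i + 1))].

(** The one-block code induced by a map of letters. *)
Definition letter_map (B A : Type) (g : B -> A) (x : config M B) : config M A :=
  fun i => g (x i).

Lemma vertex_shift_closed (B : choiceType) (R : rel B) :
  closed (@vertex_shift B R).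
Proof.
move=> x xS i.
have [y [Sy [yi yi1]]] :=
  xS _ (filterI (near_coord x i) (near_coord x (i + 1))).
by rewrite -yi -yi1.
Qed.

Lemma vertex_shift_sft (B : finType) (R : rel B) : sft (@vertex_shift B R).
Proof.
split; first split; first exact: vertex_shift_closed.
  by move=> m x Sx i; rewrite /shift_by addrAC; exact: Sx.
exists [seq [:: p.1; p.2] | p <- enum [pred p : B * B | ~~ R p.1 p.2]].
apply/seteqP; split=> x Sx.
  move=> w i /mapP[[a b]]; rewrite mem_enum inE /= => nR -> [ea eb].
  by move: nR; rewrite ea eb addr0 Sx.
move=> i; apply/negPn/negP => nR.
apply: (Sx [:: x i; x (i + 1)] i); last by rewrite /occurs_at /mkseq /= addr0.
by apply/mapP; exists (x i, x (i + 1)) => //; rewrite mem_enum.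
Qed.

Lemma letter_map_continuous (B A : choiceType) (g : B -> A) :
  continuous (letter_map g).
Proof.
apply: continuous_config => x i.
by apply: filterS (near_coord x i) => y /=; rewrite /letter_map => ->.
Qed.

Lemma letter_map_sofic (B A : finType) (R : rel B) (g : B -> A) :
  sofic (letter_map g @` @vertex_shift B R).
Proof.
have gS : {within @vertex_shift B R, continuous (letter_map g)}.
  by apply: continuous_subspaceT; exact: letter_map_continuous.
split; first split.
- apply: compact_closed; first exact: config_hausdorff.
  apply: continuous_compact => //.
  apply: subclosed_compact (@config_compact M B) _ => //.
  exact: vertex_shift_closed.
- move=> m _ [x Sx <-]; exists (shift_by m x) => //.
  by have [[_ +] _] := vertex_shift_sft R; exact.
exists B, (@vertex_shift B R), (letter_map g); split=> //.
exact: vertex_shift_sft.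
Qed.

End VertexShift.

(** * Closed omega-regular languages *)

(** A finite automaton reading infinite words in which every infinite run from
    an initial state is accepting. *)
Record safety_automaton (A : Type) := SafetyAutomaton {
  safety_state : finType;
  safety_init : {set safety_state};
  safety_trans : safety_state -> A -> {set safety_state} }.

Definition safety_run (A : Type) (B : safety_automaton A) (w : nat -> A)
    (r : nat -> safety_state B) : Prop :=
  r 0%N \in safety_init B /\
  forall i : nat, r i.+1 \in safety_trans (r i) (w i).

Section ClosedBuchi.
Variables (A : finType) (B : buchi_automaton A).

(** r is an accepting run of B on w from the state q, initial or not. *)
Definition accepting_from (q : buchi_state B) (w : nat -> A)
    (r : nat -> buchi_state B) : Prop :=
  [/\ r 0%N = q, forall i, r i.+1 \in buchi_trans (r i) (w i) &
      forall n : nat, exists2 m : nat, (n <= m)%N & r m \in buchi_accept B].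

(** The states from which some infinite word is accepted. *)
Definition live (q : buchi_state B) : Prop := exists w r, accepting_from q w r.

(** The automaton B restricted to its live states, without acceptance
    condition. *)
Definition live_part : safety_automaton A :=
  @SafetyAutomaton A (buchi_state B)
    [set q in buchi_init B | `[< live q >]]
    (fun q a => [set q' in buchi_trans q a | `[< live q' >]]).

Lemma live_shift (w : nat -> A) (r : nat -> buchi_state B) :
  buchi_run w r ->
  (forall n : nat, exists2 m : nat, (n <= m)%N & r m \in buchi_accept B) ->
  forall n, live (r n).
Proof.
move=> [_ rT] rF n; exists (fun i => w (n + i)%N), (fun i => r (n + i)%N).
split=> [|i|k]; first by rewrite addn0.
  by rewrite addnS; exact: rT.
have [m km Fm] := rF (n + k)%N; exists (m - n)%N.
  by rewrite leq_subRL; lia.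
by rewrite subnKC//; lia.
Qed.

(** A run through live states can be left at any time n for an accepting run,
    so that every prefix of its label is a prefix of an accepted word. *)
Lemma safety_run_approx (w : nat -> A) (r : nat -> buchi_state B) (n : nat) :
  @safety_run A live_part w r ->
  exists2 w', buchi_language B w' & forall i, (i < n)%N -> w' i = w i.
Proof.
move=> [r0 rT].
have : live (r n).
  by case: n => [|n]; [move: r0|move: (rT n)]; rewrite inE => /andP[_ /asboolP].
move=> [v [s [s0 sT sF]]].
exists (fun i => if (i < n)%N then w i else v (i - n)%N); last by move=> i ->.
exists (fun i => if (i < n)%N then r i else s (i - n)%N); first split.
- case: n s0 => [|n] s0 /=; last by move: r0; rewrite inE => /andP[].
  by rewrite s0; move: r0; rewrite inE => /andP[].
- move=> i; have [ltin|leni] := ltnP i n; last first.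
    by rewrite ltnNge leqW //= subSn.
  have := rT i; rewrite inE => /andP[ri _].
  have [//|lenSi] := ltnP i.+1 n.
  have -> : i.+1 = n by lia.
  by rewrite subnn s0; have <- : i.+1 = n by lia.
- move=> k; have [m km Fm] := sF k; exists (n + m)%N; first by lia.
  by rewrite ltnNge leq_addr /= addKn.
Qed.

Lemma closed_buchi_safety : closed (buchi_language B) ->
  buchi_language B = [set w | exists r, @safety_run A live_part w r].
Proof.
move=> clL; apply/seteqP; split=> w.
  move=> [r rw rF]; have lr := live_shift rw rF; case: rw => r0 rT.
  exists r; split=> [|i]; rewrite inE ?r0 ?rT; exact/asboolP.
move=> [r rw].
have /choice[h hP] n : exists w', buchi_language B w' /\
    forall i, (i < n)%N -> w' i = w i.
  by have [w' ? ?] := safety_run_approx n rw; exists w'.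
apply: (@closed_cvg _ _ \oo _ h _ clL).
  by apply: nearW => n; exact: (hP n).1.
apply: cvg_config => i; exists i.+1 => // n /=; exact: (hP n).2.
Qed.

End ClosedBuchi.

Lemma closed_omega_automatic_safety (A : finType) (L : set (config nat A)) :
  closed L -> omega_automatic L ->
  exists B : safety_automaton A, L = [set w | exists r, @safety_run A B w r].
Proof.
by move=> clL [B LB]; exists (live_part B); rewrite LB closed_buchi_safety -?LB.
Qed.

(** * Marked words *)

(** The properties of the index set, satisfied by nat and int, on which the
    construction rests: any two positions differ by a natural number, the
    successor is injective, and it has no cycle. *)
Definition line_like (M : pzSemiRingType) : Prop :=
  [/\ forall i j : M, exists k : nat, j = i + k%:R \/ i = j + k%:R,
      forall i j : M, i + 1 = j + 1 -> i = j &
      forall (i : M) (k : nat), i + k.+1%:R <> i].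

Section MarkedWords.
Variables (M : pzSemiRingType) (hM : line_like M).
Implicit Types (n i : M) (k : nat).

Lemma line_addI n k l : n + k%:R = n + l%:R -> k = l.
Proof.
have [_ canc nz] := hM.
elim: k l => [|k IHk] [|l] //.
- by rewrite addr0 => /esym/nz.
- by rewrite addr0 => /nz.
- by rewrite -!natr1 !addrA => /canc/IHk ->.
Qed.

Lemma line_cases n i :
  (exists k, i = n + k%:R) \/ (exists k, n = i + k.+1%:R).
Proof.
have [+ _ _] := hM => /(_ n i)[k [->|->]]; first by left; exists k.
by case: k => [|k]; [left; exists 0%N; rewrite !addr0 | right; exists k].
Qed.

(** A property invariant under the successor in both directions holds
    everywhere or nowhere. *)
Lemma line_ind (P : M -> Prop) : (forall i, P i <-> P (i + 1)) ->
  forall i j, P i -> P j.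
Proof.
move=> P1; have Pk i k : P i <-> P (i + k%:R).
  by elim: k => [|k IHk]; rewrite ?addr0// -natr1 addrA IHk.
move=> i j Pi; have [+ _ _] := hM => /(_ i j)[k [->|ijk]].
  exact: (Pk i k).1.
by apply: (Pk j k).2; rewrite -ijk.
Qed.

(** The code of the word w at level n: blank (None) before n, and the letter
    w k at position n + k, with the mark true exactly when k = 0. *)
Definition marked_word (A : Type) (w : nat -> A) (n : M) :
    config M (option (bool * A)) :=
  fun i => if pselect (exists k, i = n + k%:R) is left ik then
             Some (projT1 (cid ik) == 0%N, w (projT1 (cid ik)))
           else None.

(** The blank configuration and the configurations of unmarked letters without
    any blank: these are the codes of the point at infinity. *)
Definition unmarked (A : Type) (x : config M (option (bool * A))) : Prop :=
  (forall i, x i = None) \/ (forall i, exists a, x i = Some (false, a)).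

Section Letters.
Variables (A : Type).
Implicit Types (w : nat -> A) (x : config M (option (bool * A))).

Lemma marked_word_ge w n k : marked_word w n (n + k%:R) = Some (k == 0%N, w k).
Proof.
rewrite /marked_word; case: pselect => [ik|[]]; last by exists k.
by have /line_addI <- := projT2 (cid ik).
Qed.

Lemma marked_word_start w n : marked_word w n n = Some (true, w 0%N).
Proof. by rewrite -{2}[n]addr0 (marked_word_ge w n 0). Qed.

Lemma marked_word_lt w n i k : n = i + k.+1%:R -> marked_word w n i = None.
Proof.
move=> nik; rewrite /marked_word; case: pselect => // -[l il].
have [_ _ /(_ n (l + k)%N)[]] := hM.
by rewrite -addnS natrD addrA -il -nik.
Qed.

Lemma marked_wordP w n i a : marked_word w n i = Some (true, a) -> i = n.
Proof.
have [[k ->]|[k /(marked_word_lt w) ->]//] := line_cases n i.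
by rewrite marked_word_ge => -[/eqP-> _]; rewrite addr0.
Qed.

Lemma marked_word_pos_inj w w' n n' :
  marked_word w n = marked_word w' n' -> n = n'.
Proof.
move=> /(congr1 (@^~ n)); rewrite marked_word_start => /esym.
exact: marked_wordP.
Qed.

Lemma marked_word_inj w w' n : marked_word w n = marked_word w' n -> w = w'.
Proof.
move=> ww'; apply: funext => k.
by have := congr1 (@^~ (n + k%:R)) ww'; rewrite !marked_word_ge => -[].
Qed.

Lemma unmarked_letter x n a : unmarked x -> x n <> Some (true, a).
Proof. by move=> [/(_ n) ->|/(_ n)[b ->]]. Qed.

Lemma marked_word_marked w n : ~ unmarked (marked_word w n).
Proof. by move=> /unmarked_letter/(_ (marked_word_start w n)). Qed.

Lemma shift_marked_word w n :
  shift_by 1 (marked_word w (n + 1)) = marked_word w n.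
Proof.
apply: funext => i; rewrite /shift_by.
have [[k ->]|[k nik]] := line_cases n i.
  by rewrite addrAC !marked_word_ge.
by rewrite (marked_word_lt w nik) (@marked_word_lt _ _ _ k)// nik addrAC.
Qed.

(** If the mark sits at a position without predecessor, the shift erases it. *)
Lemma shift_marked_word_first w n :
  (forall m, n <> m + 1) -> unmarked (shift_by 1 (marked_word w n)).
Proof.
move=> n0; right => i; rewrite /shift_by.
have [[[|k] ik]|[k]] := line_cases n (i + 1).
- by case: (n0 i); rewrite ik addr0.
- by rewrite ik marked_word_ge; exists (w k.+1).
- by rewrite addrAC => /n0.
Qed.

Lemma shift_unmarked x : unmarked x -> unmarked (shift_by 1 x).
Proof. by move=> [x0|x1]; [left|right] => i; rewrite /shift_by. Qed.

(** The rule governing blanks and marks, whatever the letters: a blank is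
    followed by a blank or a marked letter, and a letter by an unmarked
    letter. *)
Definition pattern_step (u v : option (bool * A)) : bool :=
  match u, v with
  | None, None => true
  | None, Some (b, _) => b
  | Some _, Some (b, _) => ~~ b
  | Some _, None => false
  end.

Lemma patternP x : (forall i, pattern_step (x i) (x (i + 1))) ->
  (exists n w, x = marked_word w n) \/ unmarked x.
Proof.
move=> px.
have [[n [a xn]]|nomark] := pselect (exists n a, x n = Some (true, a)).
  left; exists n.
  have pos k : exists b, x (n + k%:R) = Some (k == 0%N, b).
    case: k => [|k]; first by exists a; rewrite addr0.
    have [b xk] : exists b, x (n + k%:R) = Some b.
      elim: k => [|k [b xk]]; first by exists (true, a); rewrite addr0.
      have := px (n + k%:R); rewrite xk -addrA natr1.
      by case: (x _) => // c _; exists c.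
    have := px (n + k%:R); rewrite xk -addrA natr1 /=.
    by case: (x _) => // -[[]] // c _; exists c.
  have [w wP] := choice pos.
  exists w; apply: funext => i.
  have [[k ->]|[k nik]] := line_cases n i; first by rewrite marked_word_ge.
  rewrite (marked_word_lt w nik).
  elim: k i nik => [|k IHk] i nik.
    by have := px i; rewrite -nik xn; case: (x i).
  have xi1 : x (i + 1) = None by apply: IHk; rewrite nik -addrA nat1r.
  by have := px i; rewrite xi1; case: (x i).
right; have nom i b : x i = Some b -> b.1 = false.
  by case: b => -[] // a xi; case: nomark; exists i, a.
have cst i : x i = None <-> x (i + 1) = None.
  have := px i; case ex: (x i) => [b|]; case ex1: (x (i + 1)) => [[c1 c2]|] //.
  by rewrite /=; have /= -> := nom _ _ ex1.
have [[i xi]|nx] := pselect (exists i, x i = None).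
  by left => j; exact: (line_ind cst) xi.
right => i; case exi: (x i) => [[b a]|]; last by case: nx; exists i.
by exists a; have /= -> := nom _ _ exi.
Qed.

End Letters.

(** The action of f on letters, preserving blanks and marks. *)
Definition map_letter (A B : Type) (f : A -> B) (u : option (bool * A)) :
  option (bool * B) := omap (fun p => (p.1, f p.2)) u.

Lemma map_marked_word (A B : Type) (f : A -> B) (w : nat -> A) n :
  letter_map (map_letter f) (marked_word w n) = marked_word (f \o w) n.
Proof.
apply: funext => i; rewrite /letter_map.
have [[k ->]|[k nik]] := line_cases n i; first by rewrite !marked_word_ge.
by rewrite !(marked_word_lt _ nik).
Qed.

Lemma map_unmarked (A B : Type) (f : A -> B)
    (x : config M (option (bool * A))) :
  unmarked x -> unmarked (letter_map (map_letter f) x).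
Proof.
move=> [x0|x1]; [left|right] => i; rewrite /letter_map ?x0//.
by have [a ->] := x1 i; exists (f a).
Qed.

(** * The sofic shifts of marked words and of pairs of marked words *)

Section MarkedRuns.
Variables (A : finType) (B : safety_automaton A).
Local Notation Q := (safety_state B).

(** The rule pattern_step refined so that the letters spell a run of B: a
    letter (a, q) stands for reading a in state q, and a marked one requires q
    to be initial. The latter is demanded also on the left argument, because a
    mark at a position without predecessor is the right argument of no pair. *)
Definition run_step (u v : option (bool * (A * Q))) : bool :=
  match u, v with
  | None, None => true
  | None, Some (b, (_, q)) => b && (q \in safety_init B)
  | Some (c, (a, q)), Some (b, (_, q')) =>
      [&& ~~ b, c ==> (q \in safety_init B) & q' \in safety_trans q a]
  | Some _, None => false
  end.

Lemma run_stepP (x : config M (option (bool * (A * Q)))) :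
  vertex_shift run_step x ->
  (exists n w r, safety_run w r /\ x = marked_word (fun k => (w k, r k)) n)
  \/ unmarked x.
Proof.
move=> Rx; have px i : pattern_step (x i) (x (i + 1)).
  move: (Rx i); case: (x i) => [[b [a q]]|];
    case: (x (i + 1)) => [[c [d q']]|] //=.
    by move=> /andP[].
  by move=> /andP[].
have [[n [w xw]]|] := patternP px; [left|by right].
exists n, (fst \o w), (snd \o w); split; last first.
  by rewrite xw; congr marked_word; apply: funext => k /=; case: (w k).
split=> [|k].
  have := Rx n; rewrite xw marked_word_start -[1]/(1%:R) marked_word_ge /=.
  by case: (w 0%N) => a q; case: (w 1%N) => b q' /= /andP[].
have := Rx (n + k%:R); rewrite xw -addrA natr1 !marked_word_ge /=.
by case: (w k) => a q; case: (w k.+1) => b q' /= /andP[].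
Qed.

Lemma marked_run_step (w : nat -> A) (r : nat -> Q) n : safety_run w r ->
  vertex_shift run_step (marked_word (fun k => (w k, r k)) n).
Proof.
move=> [r0 rT] i.
have [[k ->]|[k nik]] := line_cases n i.
  rewrite -addrA natr1 !marked_word_ge /= rT andbT.
  by case: k.
rewrite (marked_word_lt _ nik).
case: k nik => [|k] nik; first by rewrite -nik marked_word_start.
by rewrite (@marked_word_lt _ _ _ _ k)// nik -addrA nat1r.
Qed.

End MarkedRuns.

Section MarkedShift.
Variables (A : finType) (B : safety_automaton A).
Local Notation Q := (safety_state B).

(** The sofic shift of the labels of the configurations obeying run_step. *)
Definition marked_shift : set (config M (option (bool * A))) :=
  letter_map (map_letter fst) @` vertex_shift (@run_step A B).

Lemma marked_shift_sofic : sofic marked_shift.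
Proof. exact: letter_map_sofic. Qed.

Lemma marked_shiftP (x : config M (option (bool * A))) : marked_shift x ->
  (exists n w r, @safety_run A B w r /\ x = marked_word w n) \/ unmarked x.
Proof.
move=> [y /run_stepP[[n [w [r [wr ->]]]]|uy] <-]; [left|right].
  by exists n, w, r; split => //; rewrite map_marked_word.
exact: map_unmarked.
Qed.

Lemma marked_shift_word (w : nat -> A) (r : nat -> Q) n :
  safety_run w r -> marked_shift (marked_word w n).
Proof.
by move=> /(marked_run_step n) wr; eexists; [exact: wr|rewrite map_marked_word].
Qed.

Lemma marked_shift_blank : marked_shift (fun=> None).
Proof. by exists (fun=> None). Qed.

End MarkedShift.

Section MarkedPairShift.
Variables (A : finType) (B : safety_automaton (A * A)).
Local Notation Q := (safety_state B).

(** Letters of the shift covering marked_pair_shift: the left summand carries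
    the runs of B, the right one the pairs of configurations without mark. *)
Definition pair_vertex : finType :=
  (option (bool * ((A * A) * Q)) + (option A * option A))%type.

(** The summands do not mix. In the right one, each component stays blank or
    stays non-blank, independently of the other. *)
Definition pair_step (u v : pair_vertex) : bool :=
  match u, v with
  | inl u, inl v => run_step u v
  | inr (p, p'), inr (q, q') =>
      (isSome p == isSome q) && (isSome p' == isSome q')
  | _, _ => false
  end.

Definition pair_letter (u : pair_vertex) :
    option (bool * A) * option (bool * A) :=
  match u with
  | inl v => (map_letter (fun p => p.1.1) v, map_letter (fun p => p.1.2) v)
  | inr (p, q) => (omap (pair false) p, omap (pair false) q)
  end.

(** The pairs of marked words at the same level whose words form a pair
    accepted by B, and all pairs of unmarked configurations. *)
Definition marked_pair_shift :
    set (config M (option (bool * A) * option (bool * A))) :=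
  letter_map pair_letter @` vertex_shift pair_step.

Lemma marked_pair_shift_sofic : sofic marked_pair_shift.
Proof. exact: letter_map_sofic. Qed.

Lemma unmarkedE (x : config M (option (bool * A))) :
  unmarked x <-> exists2 p : config M (option A),
    x = letter_map (omap (pair false)) p &
    forall i, isSome (p i) = isSome (p (i + 1)).
Proof.
split=> [[x0|x1]|[p -> pc]].
- by exists (fun=> None) => //; apply: funext.
- have [p pP] := choice x1.
  by exists (fun i => Some (p i)) => //; apply: funext.
- have cst i : isSome (p i) <-> isSome (p (i + 1)) by rewrite pc.
  have [[i pi]|np] := pselect (exists i, isSome (p i)).
    right => j; have := line_ind cst j pi; rewrite /letter_map.
    by case: (p j) => // a _; exists a.
  left => i; rewrite /letter_map; case e: (p i) => [a|] //.
  by case: np; exists i; rewrite e.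
Qed.

Lemma marked_pair_shiftP (x y : config M (option (bool * A))) :
  marked_pair_shift (pairc x y) <->
  (exists n u v r, [/\ @safety_run _ B (pairc u v) r,
     x = marked_word u n & y = marked_word v n]) \/
  (unmarked x /\ unmarked y).
Proof.
split.
- move=> [z Rz zxy].
  have -> : x = letter_map (fst \o pair_letter) z.
    apply: funext => i; have := congr1 (@^~ i) zxy.
    by rewrite /letter_map /= => ->.
  have -> : y = letter_map (snd \o pair_letter) z.
    apply: funext => i; have := congr1 (@^~ i) zxy.
    by rewrite /letter_map /= => ->.
  pose isl i := if z i is inl _ then True else False.
  have cst i : isl i <-> isl (i + 1).
    by have := Rz i; rewrite /isl; case: (z i) => [|[? ?]]; case: (z (i + 1)).
  have [[i li]|nl] := pselect (exists i, isl i).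
    have /choice[t tP] j : exists t, z j = inl t.
      have := line_ind cst j li.
      by rewrite /isl; case: (z j) => // t _; exists t.
    have zE : z = letter_map inl t by apply: funext.
    have Rt : vertex_shift (@run_step _ B) t.
      by move=> j; have := Rz j; rewrite !tP.
    have -> : letter_map (fst \o pair_letter) z =
              letter_map (map_letter (fun p => p.1.1)) t by rewrite zE.
    have -> : letter_map (snd \o pair_letter) z =
              letter_map (map_letter (fun p => p.1.2)) t by rewrite zE.
    have [[n [w [r [wr ->]]]]|ut] := run_stepP Rt; [left|right].
      exists n, (fun k => (w k).1), (fun k => (w k).2), r.
      rewrite !map_marked_word; split => //.
      suff -> : pairc (fun k => (w k).1) (fun k => (w k).2) = w by [].
      by apply: funext => k; rewrite /pairc; case: (w k).
    by split; exact: map_unmarked.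
  have /choice[t tP] j : exists t, z j = inr t.
    by case e: (z j) => [u|t]; [case: nl; exists j; rewrite /isl e|exists t].
  have ct j : isSome (t j).1 = isSome (t (j + 1)).1 /\
              isSome (t j).2 = isSome (t (j + 1)).2.
    have := Rz j; rewrite !tP /=.
    case: (t j) => p q; case: (t (j + 1)) => p' q'.
    by move=> /andP[/eqP ? /eqP ?].
  right; split; apply/unmarkedE.
    exists (fun i => (t i).1) => [|i]; last by have [] := ct i.
    by apply: funext => i; rewrite /letter_map /= tP; case: (t i).
  exists (fun i => (t i).2) => [|i]; last by have [] := ct i.
  by apply: funext => i; rewrite /letter_map /= tP; case: (t i).
- move=> [[n [u [v [r [uvr -> ->]]]]]|].
    exists (letter_map inl (marked_word (fun k => ((u k, v k), r k)) n)).
      by move=> i; exact: marked_run_step uvr i.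
    rewrite /pairc; apply: funext => i.
    have /(congr1 (@^~ i)) := map_marked_word (fun p => p.1.1)
      (fun k => ((u k, v k), r k)) n.
    have /(congr1 (@^~ i)) := map_marked_word (fun p => p.1.2)
      (fun k => ((u k, v k), r k)) n.
    by rewrite /letter_map /= => -> ->.
  move=> [/unmarkedE[p -> pc] /unmarkedE[q -> qc]].
  exists (fun i => inr (p i, q i)) => // i.
  by rewrite /= pc qc !eqxx.
Qed.

End MarkedPairShift.
End MarkedWords.

(** * The arrow space as a quotient of the shift of marked words *)

(** A presentation of X: the maps f and g are inverse homeomorphisms between
    X and the quotient of Y by e, the restriction of Z to Y, and Y and Z are
    the languages of the safety automata BY and BZ. *)
Section ArrowPresentation.
Variables (M : pzSemiRingType) (hM : line_like M).
Variables (A : finType) (Y : set (config nat A)) (Z : set (config nat (A * A))).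
Variables (e : equiv_rel Y) (X : topologicalType).
Variables (f : quot e -> X) (g : X -> quot e).
Hypotheses (fK : cancel f g) (gK : cancel g f).
Hypotheses (f_cont : continuous f) (g_cont : continuous g).
Variables (BY : safety_automaton A) (BZ : safety_automaton (A * A)).
Hypothesis YE : Y = [set w | exists r, @safety_run A BY w r].
Hypothesis ZE : Z = [set w | exists r, @safety_run (A * A) BZ w r].
Hypothesis Y_closed : closed Y.
Hypothesis ZY : forall x y, Z (pairc x y) -> Y x /\ Y y.
Hypothesis eZ : restricts_to Z e.

Local Notation C := (config M (option (bool * A))).
Local Notation Y' := (@marked_shift M A BY).
Local Notation Z' := (@marked_pair_shift M A BZ).

(** The point of X represented by a word of Y. *)
Definition present (u : Y) : X := f (\pi_(quot e) u).

Lemma present_continuous : continuous present.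
Proof.
move=> u; apply: continuous_comp; last exact: f_cont.
exact: (@pi_continuous _ {eq_quot e}).
Qed.

Lemma presentP (u v : Y) :
  present u = present v <-> Z (pairc (set_val u) (set_val v)).
Proof.
rewrite -eZ /present; split=> [/(can_inj fK) uv|uv].
  exact/(@eqmodP _ e).
by congr f; exact/(@eqmodP _ e).
Qed.

Lemma present_repr (x : X) : present (repr (g x)) = x.
Proof. by rewrite /present reprK gK. Qed.

Lemma presented_space_compact : compact [set: X].
Proof.
have -> : [set: X] = present @` setT.
  apply/seteqP; split=> // x _.
  by exists (repr (g x)) => //; exact: present_repr.
apply: continuous_compact.
  by apply: continuous_subspaceT; exact: present_continuous.
apply: compact_set_type.
exact: subclosed_compact Y_closed (@config_compact nat A) _.
Qed.

Definition word_config (u : Y) (n : M) : C := marked_word (set_val u) n.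

Lemma word_configP (x : C) : Y' x ->
  (exists u n, x = word_config u n) \/ unmarked x.
Proof.
move=> /(marked_shiftP hM)[[n [w [r [wr ->]]]]|]; [left|by right].
have Yw : Y w by rewrite YE; exists r.
by exists (SigSub (mem_set Yw)), n.
Qed.

Lemma point_configP (x : Y') :
  (exists u n, set_val x = word_config u n) \/ unmarked (set_val x).
Proof. exact: word_configP (set_valP x). Qed.

Lemma word_config_shift (u : Y) n : Y' (word_config u n).
Proof.
have := set_valP u; rewrite {1}YE => -[r ur].
exact: marked_shift_word ur.
Qed.

(** The point encoded by a configuration. Every configuration that is not a
    marked word over Y is sent to infinity. *)
Definition decode (x : C) : arrow_space M X :=
  if pselect (exists p : M * Y, x = word_config p.2 p.1) is left xp then
    let p := projT1 (cid xp) in Some (present p.2, p.1)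
  else None.

Lemma decode_word (u : Y) n : decode (word_config u n) = Some (present u, n).
Proof.
rewrite /decode; case: pselect => [xp|[]]; last by exists (n, u).
case: (cid xp) => -[m v] /= uv.
have mn := marked_word_pos_inj hM uv; rewrite -mn in uv *.
by rewrite (val_inj (marked_word_inj hM uv)).
Qed.

Lemma decode_unmarked (x : C) : unmarked x -> decode x = None.
Proof.
move=> ux; rewrite /decode; case: pselect => // xp.
case: (cid xp) => -[n u] /= xu.
by move: ux; rewrite xu => /(marked_word_marked hM).
Qed.

Lemma decodeP (x y : C) : Y' x -> Y' y ->
  decode x = decode y <-> Z' (pairc x y).
Proof.
move=> Yx Yy; rewrite marked_pair_shiftP//; split.
  have [[u [n ->]]|ux] := word_configP Yx;
    have [[v [m ->]]|uy] := word_configP Yy.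
  - rewrite !decode_word => -[/presentP + <-]; rewrite ZE => -[r uvr].
    by left; exists n, (set_val u), (set_val v), r.
  - by rewrite decode_word decode_unmarked.
  - by rewrite decode_word decode_unmarked.
  - by right.
move=> [[n [u [v [r [uvr -> ->]]]]]|[ux uy]]; last by rewrite !decode_unmarked.
have Zuv : Z (pairc u v) by rewrite ZE; exists r.
have [Yu Yv] := ZY Zuv.
rewrite (decode_word (SigSub (mem_set Yu))) (decode_word (SigSub (mem_set Yv))).
by congr (Some (_, _)); apply/presentP.
Qed.

Lemma decode_marked (x : C) p n : decode x = Some (p, n) ->
  exists a, x n = Some (true, a).
Proof.
rewrite /decode; case: pselect => // xp; case: (cid xp) => -[m u] /= -> [_ <-].
by exists (set_val u 0%N); exact: marked_word_start.
Qed.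

Lemma word_config_continuous n : continuous (word_config ^~ n).
Proof.
apply: continuous_config => u i.
have [[k ->]|[k nik]] := line_cases hM n i; last first.
  apply: (@filterE Y (nbhs u)) => v.
  by rewrite /word_config !(marked_word_lt hM _ nik).
have uk : \forall v \near u, set_val v k = set_val u k.
  exact: (@initial_continuous _ _ (set_val : Y -> _) u _ (near_coord _ k)).
apply: (@filterS Y (nbhs u) _ _ _ _ uk) => v.
by rewrite /word_config !marked_word_ge// => ->.
Qed.

(** The word coded by x at level n, with default value u. *)
Definition tail_word (n : M) (u : Y) (x : C) : Y :=
  if pselect (exists v, x = word_config v n) is left xv then projT1 (cid xv)
  else u.

(** Reading off the word is continuous at the code of u: configurations that
    are not codes at level n take the default value u, the limit itself. *)
Lemma tail_word_cvg (n : M) (u : Y) : tail_word n u @ word_config u n --> u.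
Proof.
apply: (@cvg_set_type _ Y C (nbhs (word_config u n)) _ (tail_word n u) u).
apply: cvg_config => k.
apply: filterS (near_coord (word_config u n) (n + k%:R)) => x.
rewrite /= /tail_word; case: pselect => // xv; case: (cid xv) => v /= ->.
by rewrite /word_config !marked_word_ge// => -[].
Qed.

Lemma decode_continuous : continuous (decode \o (set_val : Y' -> C)).
Proof.
move=> x U nU.
have {}nU : nbhs (decode (set_val x)) U by exact: nU.
have val_cvg : (set_val : Y' -> C) @ x --> set_val x.
  exact: initial_continuous.
have [[u [n xu]]|ux] := point_configP x.
  move: nU; rewrite xu decode_word => nU.
  have {}nU : nbhs (present u, n : discrete_topology M)
    [set p | U (Some p)] by [].
  have [[P Q] /= [Pu Qn] PQ] := nU.
  have Pw : \forall y \near set_val x, P (present (tail_word n u y)).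
    have nP : nbhs u (present @^-1` P) by exact: (present_continuous Pu).
    by rewrite xu; exact: (@tail_word_cvg n u _ nP).
  have yx : \forall y \near set_val x, y n = set_val x n by exact: near_coord.
  have {}Pw : nbhs x [set y : Y' | P (present (tail_word n u (set_val y)))].
    exact: val_cvg Pw.
  have {}yx : nbhs x [set y : Y' | set_val y n = set_val x n].
    exact: val_cvg yx.
  apply: (@filterS2 Y' (nbhs x) _ _ _ _ _ Pw yx) => y Py yn.
  have yn1 : set_val y n = Some (true, set_val u 0%N).
    by rewrite yn xu /word_config marked_word_start.
  have [[v [m yv]]|uy] := point_configP y; last first.
    by case: (unmarked_letter uy yn1).
  have mn : n = m by move: yn1; rewrite yv => yn1; exact: (marked_wordP hM yn1).
  change (U (decode (set_val y))); rewrite yv decode_word -mn.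
  apply: (PQ (present v, n)); split => /=.
    move: (Py : P _); rewrite /tail_word; case: pselect => [yv'|[]]; last first.
      by exists v; rewrite yv mn.
    case: (cid yv') => v' /= vv'; suff -> : v' = v by [].
    apply: val_inj; apply: (@marked_word_inj M hM _ _ _ n).
    by move: vv'; rewrite yv mn.
  exact: (nbhs_singleton Qn).
move: nU; rewrite decode_unmarked// => -[K [cK _] KU].
(* D contains all the levels met by the compact set K. *)
have [p Kp|D KD] := @compact_finite_choice _ M K
    (fun n => [set p | p.2 = n]) cK.
  exists p.2; exists (setT, [set p.2]); last by move=> [? ?] [].
  by split; [exact: filterT|exact: (@discrete_set1 (discrete_topology M))].
have xD : nbhs x
    [set y : Y' | forall i, i \in D -> set_val y i = set_val x i].
  exact: val_cvg (near_coords D (set_val x)).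
apply: (@filterS Y' (nbhs x) _ _ _ _ xD) => y yD.
change (U (decode (set_val y))); apply: KU.
case dy: (decode (set_val y)) => [p|]; [left|by right].
exists p => // /KD [n nD pn].
have yn : set_val y n = set_val x n by exact: yD.
case: p pn dy => p m /= -> /decode_marked [a]; rewrite yn.
exact: unmarked_letter.
Qed.

(** The relation of encoding the same point. *)
Definition arrow_rel (x y : Y') : bool :=
  `[< decode (set_val x) = decode (set_val y) >].

Lemma arrow_rel_refl : reflexive arrow_rel.
Proof. by move=> x; apply/asboolP. Qed.

Lemma arrow_rel_sym : symmetric arrow_rel.
Proof. by move=> x y; apply/asboolP/asboolP. Qed.

Lemma arrow_rel_trans : transitive arrow_rel.
Proof. by move=> y x z /asboolP xy /asboolP yz; apply/asboolP; rewrite xy. Qed.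

Definition arrow_equiv : equiv_rel Y' :=
  EquivRel arrow_rel arrow_rel_refl arrow_rel_sym arrow_rel_trans.

Lemma arrow_equivP (x y : Y') :
  \pi_(quot arrow_equiv) x = \pi_(quot arrow_equiv) y <->
  decode (set_val x) = decode (set_val y).
Proof.
split=> [/(@eqmodP _ arrow_equiv)/asboolP//|xy].
by apply/(@eqmodP _ arrow_equiv)/asboolP.
Qed.

(** The homeomorphism induced by decode. *)
Definition to_arrow (q : quot arrow_equiv) : arrow_space M X :=
  decode (set_val (repr q)).

Lemma to_arrow_pi (x : Y') :
  to_arrow (\pi_(quot arrow_equiv) x) = decode (set_val x).
Proof. by apply/arrow_equivP; rewrite reprK. Qed.

Definition word_point (u : Y) (n : M) : Y' :=
  SigSub (mem_set (word_config_shift u n)).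

Definition blank_point : Y' := SigSub (mem_set (@marked_shift_blank M A BY)).

(** Its inverse, choosing a representative of x in Y. *)
Definition of_arrow (p : arrow_space M X) : quot arrow_equiv :=
  if p is Some (x, n) then \pi_(quot arrow_equiv) (word_point (repr (g x)) n)
  else \pi_(quot arrow_equiv) blank_point.

Lemma decode_blank : decode (set_val blank_point) = None.
Proof. by apply: decode_unmarked; left. Qed.

Lemma of_arrowK : cancel of_arrow to_arrow.
Proof.
move=> [[x n]|]; rewrite /of_arrow to_arrow_pi ?decode_blank//.
by rewrite decode_word present_repr.
Qed.

Lemma to_arrow_inj : injective to_arrow.
Proof. by move=> p q /arrow_equivP; rewrite !reprK. Qed.

Lemma to_arrowK : cancel to_arrow of_arrow.
Proof. by move=> q; apply: to_arrow_inj; rewrite of_arrowK. Qed.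

Lemma to_arrow_continuous : continuous to_arrow.
Proof.
apply/(@quotient_continuous _ {eq_quot arrow_equiv}).
suff -> : to_arrow \o \pi_(quotient_topology {eq_quot arrow_equiv}) =
    decode \o set_val by exact: decode_continuous.
by apply: funext => x; exact: to_arrow_pi.
Qed.

Lemma word_class_continuous n :
  continuous (fun x : X => \pi_(quot arrow_equiv) (word_point (repr (g x)) n)).
Proof.
pose phi (q : quot e) := \pi_(quot arrow_equiv) (word_point (repr q) n).
move=> x; apply: (@continuous_comp _ _ _ g phi); first exact: g_cont.
move: (g x); apply/(@quotient_continuous _ {eq_quot e}).
have -> : phi \o \pi_(quotient_topology {eq_quot e}) =
    \pi_(quot arrow_equiv) \o (word_point ^~ n).
  apply: funext => u; apply/arrow_equivP; rewrite !decode_word.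
  by rewrite /present reprK.
move=> u; apply: continuous_comp; last first.
  exact: (@pi_continuous _ {eq_quot arrow_equiv}).
apply: (@cvg_set_type _ Y' Y (nbhs u) _ (word_point ^~ n)).
exact: (@word_config_continuous n u).
Qed.

Lemma of_arrow_continuous : continuous of_arrow.
Proof.
move=> [[x n]|] U nU.
  change (nbhs (x, n : discrete_topology M) [set p | U (of_arrow (Some p))]).
  exists ([set y | U (of_arrow (Some (y, n)))], [set n]).
    by split; [exact: word_class_continuous nU|
               exact: (@discrete_set1 (discrete_topology M))].
  by move=> [y m] /= [Uy ->].
move: nU; rewrite nbhsE => -[O [oO Ob] OU].
have [W oW WO] : open (\pi_(quot arrow_equiv) @^-1` O) by exact: oO.
have WP (x : Y') : W (set_val x) <-> O (\pi_(quot arrow_equiv) x).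
  by rewrite -[X in _ <-> X]/((_ @^-1` O) x) -WO.
(* The configurations outside W all have a mark, at finitely many positions D
   by compactness; the points whose level lies outside D are then mapped
   into O. *)
have cK : compact (Y' `&` ~` W).
  apply: compact_closedI; last exact: open_closedC.
  apply: subclosed_compact (@config_compact M _) _ => //.
  exact: (marked_shift_sofic M BY).1.1.
have [x [Yx nWx]|D KD] := @compact_finite_choice _ M _
    (fun n => [set x : C | exists a, x n = Some (true, a)]) cK.
  have [[u [n xu]]|ux] := word_configP Yx.
    exists n; apply: filterS (near_coord x n) => y /= ->.
    by exists (set_val u 0%N); rewrite xu /word_config marked_word_start.
  case: nWx; apply/(WP (SigSub (mem_set Yx))).
  suff -> : \pi_(quot arrow_equiv) (SigSub (mem_set Yx)) =
      \pi_(quot arrow_equiv) blank_point by [].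
  by apply/arrow_equivP; rewrite decode_blank decode_unmarked.
exists ([set: X] `*` [set` D]).
  split.
    apply: compact_setX; first exact: presented_space_compact.
    by apply: finite_compact; exact: finite_seq.
  have -> : [set: X] `*` [set` D] =
      (snd : X * discrete_topology M -> discrete_topology M) @^-1` [set` D].
    by apply/seteqP; split=> [p []|p].
  apply: preimage_closed => [p _|]; first exact: cvg_snd.
  exact: (@discrete_closed (discrete_topology M)).
move=> _ [[[x n] /= nD <-]|->]; last exact: OU.
suff Wxn : W (set_val (word_point (repr (g x)) n)) by apply: OU; exact/WP.
apply: contrapT => nW.
have [m mD [a]] := KD _ (conj (set_valP (word_point (repr (g x)) n)) nW).
by move=> ma; apply: nD; split=> //=; rewrite -(marked_wordP hM ma).
Qed.

Lemma word_config_step (u : Y) n :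
  shift_by 1 (word_config u (n + 1)) = word_config u n.
Proof. exact: shift_marked_word. Qed.

Lemma arrow_sofically_presented (s : arrow_space M X -> arrow_space M X) :
  s None = None -> (forall x n, s (Some (x, n + 1)) = Some (x, n)) ->
  (forall x n, (forall m, n <> m + 1) -> s (Some (x, n)) = None) ->
  sofically_presented M s.
Proof.
move=> s0 s1 sn.
exists (option (bool * A) : finType), Y', Z'.
exists (marked_shift_sofic M BY), arrow_equiv.
split; first exact: marked_pair_shift_sofic.
  move=> x y; rewrite -decodeP; [|exact: set_valP|exact: set_valP].
  by split=> [/asboolP|?]; last apply/asboolP.
exists to_arrow.
  exists of_arrow; split; [exact: to_arrowK|exact: of_arrowK|
    exact: to_arrow_continuous|exact: of_arrow_continuous].
move=> q; rewrite /quot_shift -lock to_arrow_pi /to_arrow.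
have -> : set_val (subshift_map (marked_shift_sofic M BY).1 (repr q)) =
  shift_by 1 (set_val (repr q)) by [].
have [[u [n xu]]|ux] := point_configP (repr q); last first.
  by rewrite (decode_unmarked ux) s0 decode_unmarked//; exact: shift_unmarked.
rewrite xu decode_word.
have [[m ->]|nn] := pselect (exists m, n = m + 1).
  by rewrite s1 word_config_step decode_word.
rewrite sn => [|m nm]; last by apply: nn; exists m.
apply: decode_unmarked; apply: (shift_marked_word_first hM) => m nm.
by apply: nn; exists m.
Qed.

End ArrowPresentation.

(** * Natural numbers and integers *)

Lemma line_like_nat : line_like nat.
Proof.
have nE (i : nat) k : i + k%:R = (i + k)%N by rewrite natn.
split=> [i j|i j|i k].
- have [/subnKC ij|/ltnW/subnKC ji] := leqP i j.
    by exists (j - i)%N; left; rewrite nE ij.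
  by exists (i - j)%N; right; rewrite nE ji.
- exact: (@addIn 1%N).
- by rewrite nE; lia.
Qed.

Lemma line_like_int : line_like int.
Proof.
split=> [i j|i j|i k].
- exists `|j - i|%N; rewrite !natz; lia.
- exact: addIr.
- by rewrite natz; lia.
Qed.

Theorem theorem8p4 (X : topologicalType) (hX : compact_automatic_space X) :
  sofically_presented int (@leftright_arrow_map X) /\
  sofically_presented nat (@right_arrow_map X).
Proof.
have [A [Y [Z [e [[clY aY] [clZ aZ] ZY eZ [f [g [fK gK cf cg]]]]]]]] := hX.
have [BY YE] := closed_omega_automatic_safety clY aY.
have [BZ ZE] := closed_omega_automatic_safety clZ aZ.
split.
- apply: (arrow_sofically_presented line_like_int fK gK cf cg YE ZE) => //.
  + by move=> x n /=; rewrite addrK.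
  + by move=> x n /(_ (n - 1)); rewrite subrK.
- apply: (arrow_sofically_presented line_like_nat fK gK cf cg YE ZE) => //.
  + by move=> x n /=; rewrite -[(n + 1)%R]/(n + 1)%N addn1.
  + move=> x [|n] // /(_ n); rewrite -[(n + 1)%R]/(n + 1)%N addn1.
    by case.
Qed.
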